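(* Let $\mathscr A$ be a strongly subconvex $L^p$-set with $p>1$. Then for every $q\in\mathbb N$ and $a\in\mathbb Z$, the set $\mathscr B=(q\mathscr A+a)\cap\mathbb N=\{qn+a:n\in\mathscr A\}\cap\mathbb N$ is also a strongly subconvex $L^p$-set.
   Context: For $\mathscr D\subseteq\mathbb N$ write $\mathscr D(N)=\mathscr D\cap[1,N]$, $D(N)=\mathrm{card}(\mathscr D(N))$, $e(z)=e^{2\pi iz}$ and $I_p(N;\mathscr D)=\int_0^1|\sum_{n\in\mathscr D(N)}e(n\alpha)|^p\,d\alpha$. A non-empty $\mathscr D\subseteq\mathbb N$ is a strongly subconvex $L^p$-set if $0<p<2$ and for all $N$ sufficiently large in terms of $p$, $I_p(N;\mathscr D)\ll N^{-1}D(N)^p$ with implied constant independent of $N$. *)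

(* Defs.v *)
From HB Require Import structures.
From mathcomp Require Import all_boot all_order all_algebra.
From mathcomp Require Import finmap.
From mathcomp Require Import all_classical all_reals all_analysis.
From mathcomp Require Export complex.
Set Implicit Arguments.
Unset Strict Implicit.
Unset Printing Implicit Defensive.
Import Order.TTheory GRing.Theory Num.Theory.
Import numFieldNormedType.Exports.
Local Open Scope classical_set_scope.
Local Open Scope ring_scope.
Local Open Scope complex_scope.

(* The paper's natural numbers start at 1. *)
Definition pnat_set : set nat := [set n | (0 < n)%N].

(* e(x) = exp(2 pi i x), written out by Euler's formula since the library has
   no complex exponential; only real arguments are needed. *)
Definition e (R : realType) (x : R) : R[i] :=
  cos (2 * pi * x) +i* sin (2 * pi * x).

Definition trunc_set (D : set nat) (N : nat) : set nat :=
  [set n | D n /\ (1 <= n <= N)%N].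

Definition count_set (D : set nat) (N : nat) : nat :=
  #|` fset_set (trunc_set D N)|.

Definition exp_sum (R : realType) (D : set nat) (N : nat) (alpha : R) : R[i] :=
  \sum_(n <- fset_set (trunc_set D N)) e (n%:R * alpha).

(* [powR] is used because it satisfies 0 `^ p = 0 for p != 0. *)
Definition moment (R : realType) (p : R) (N : nat) (D : set nat) : R :=
  \int[@lebesgue_measure R]_(alpha in `[0, 1])
    (ComplexField.Normc.normc (exp_sum D N alpha) `^ p).

(* The implied constant [C] and the threshold on [N] may depend on [p]
   and [D]. *)
Definition strongly_subconvex (R : realType) (p : R) (D : set nat) : Prop :=
  [/\ D `<=` pnat_set, D !=set0, 0 < p < 2 &
    exists2 C : R, 0 < C &
      \forall N \near \oo,
        moment p N D <= C * (N%:R^-1 * (count_set D N)%:R `^ p)].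

Definition affine_image (q : nat) (a : int) (A : set nat) : set nat :=
  [set m | pnat_set m /\ exists2 n, A n & m%:Z = q%:Z * n%:Z + a].

(* Main.v *)
(* Translation and dilation do not affect the moments: |e(a x)| = 1, and the
   integral over a period of g(q x) is that of g. Hence the only loss comes from
   the at most |a| elements n of A with q n + a <= 0. Removing them costs O(1) in
   the moment, and since p > 1 the moment of A is at least 1 (every Fourier
   coefficient is bounded by the L^1 norm), so the O(1) is absorbed. The same lower
   bound gives M <= C A(M)^p with M = (N - a) / q, so A is infinite, B is
   nonempty, and A(M) <= B(N) + |a| <= (1 + |a|) B(N) for N large. *)
Require Import Defs.
From mathcomp Require Import all_boot all_order all_algebra.
From mathcomp Require Import finmap.
From mathcomp Require Import all_classical all_reals all_analysis.
From mathcomp Require Import zify ring lra.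
Set Implicit Arguments.
Unset Strict Implicit.
Unset Printing Implicit Defensive.
Import Order.TTheory GRing.Theory Num.Theory.
Import numFieldNormedType.Exports.
Local Open Scope classical_set_scope.
Local Open Scope ring_scope.

Local Notation normc := ComplexField.Normc.normc.
Local Notation mu := lebesgue_measure.

(** * Integrals of continuous functions over intervals and periods *)

Lemma continuous_integrable_itv (R : realType) (g : R -> R) (a b : R) :
  continuous g -> (@mu R).-integrable `[a, b] (EFin \o g).
Proof.
move=> cg; apply: continuous_compact_integrable; first exact: segment_compact.
exact: continuous_subspaceT.
Qed.

(** Away from 0 the power is differentiable; near 0 the function is squeezed between 0 and |t|. The
    absolute value keeps the base nonnegative, so that continuity holds on the whole line. *)
Lemma continuous_normr_powR (R : realType) (p : R) : 1 < p ->
  continuous (fun t : R => `|t| `^ p).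
Proof.
move=> p1 t; have p0 : 0 < p by apply: lt_trans p1.
have [->|t0] := eqVneq t 0; last first.
  apply: (@continuous_comp _ _ _ (fun t : R => `|t|) (fun u => u `^ p)).
    exact: norm_continuous.
  apply/differentiable_continuous/derivable1_diffP.
  by apply: derivable_powR; rewrite in_itv/= normr_gt0 t0.
rewrite /continuous_at normr0 powR0 ?gt_eqF//.
apply: (@squeeze_cvgr _ _ _ _ (cst 0) (fun t : R => `|t|)).
- near=> u; rewrite powR_ge0/=.
  have [->|u0] := eqVneq u 0; first by rewrite normr0 powR0 ?gt_eqF.
  apply: ge1r_powR; last exact: ltW.
  rewrite normr_gt0 u0/=; apply: ltW; near: u.
  by apply: (@cvgr0_norm_lt _ _ _ _ _ (fun u : R => u)) => //; exact: cvg_id.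
- exact: cvg_cst.
- by rewrite -[X in _ --> X](@normr0 R R); exact: norm_continuous.
Unshelve. all: by end_near. Qed.

Lemma Rintegral_affine (R : realType) (g : R -> R) (c d a b : R) :
  0 < c -> a <= b -> continuous g ->
  \int[@mu R]_(x in `[c * a + d, c * b + d]) g x =
  c * \int[@mu R]_(x in `[a, b]) g (c * x + d).
Proof.
move=> c0 ab cg.
pose F x : R := c * x + d.
have dF (x : R) : is_derive x (1 : R) F c.
  by apply: is_derive_eq; rewrite /GRing.scale/= !mulr1 addr0.
have cF : continuous F.
  by move=> x; apply/differentiable_continuous/derivable1_diffP.
have dFE : derive1 F = cst c.
  by apply/funext => x; rewrite derive1E derive_val.
rewrite -RintegralZl//; last first.
  apply: continuous_integrable_itv => x.
  by apply: continuous_comp; [exact: cF|exact: cg].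
rewrite /Rintegral (@integration_by_substitution_increasing R F g a b)//.
- by congr fine; apply: eq_integral => x _; rewrite dFE mulrC.
- by move=> x y _ _ xy; rewrite /F ltrD2r ltr_pM2l.
- by rewrite dFE => ? _; exact: cst_continuous.
- by rewrite dFE; exact: is_cvg_cst.
- by rewrite dFE; exact: is_cvg_cst.
- split; first by move=> x _.
  + by apply: cvg_at_right_filter; exact: cF.
  + by apply: cvg_at_left_filter; exact: cF.
- exact: continuous_subspaceT.
Qed.

(** Substitution gives 1/q times the integral over [0, q], which splits into q unit periods with
    equal integrals. *)
Lemma Rintegral_periodic_scale (R : realType) (g : R -> R) (q : nat) :
  (0 < q)%N -> continuous g -> (forall x, g (x + 1) = g x) ->
  \int[@mu R]_(x in `[0, 1]) g (q%:R * x) =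
  \int[@mu R]_(x in `[0, 1]) g x.
Proof.
move=> q0 cg g1.
have gn n x : g (x + n%:R) = g x.
  by elim: n x => [|n IHn] x; rewrite ?addr0// -natr1 addrA g1.
have ig (a b : R) := @continuous_integrable_itv R g a b cg.
have shift (n : nat) : \int[@mu R]_(x in `[n%:R, n.+1%:R]) g x =
    \int[@mu R]_(x in `[0, 1]) g x.
  have := @Rintegral_affine R g 1 n%:R 0 1 ltr01 ler01 cg.
  rewrite mulr0 add0r !mul1r nat1r => ->.
  by apply: eq_Rintegral => x _; rewrite mul1r gn.
have sumE (n : nat) : \int[@mu R]_(x in `[0, n%:R]) g x =
    n%:R * \int[@mu R]_(x in `[0, 1]) g x.
  elim: n => [|n IHn]; first by rewrite set_itv1 Rintegral_set1 mul0r.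
  have := @Rintegral_itvB R g (BLeft 0) (BRight n.+1%:R) n%:R (ig _ _).
  rewrite !bnd_simp ler0n ler_nat leqnSn => /(_ isT isT).
  rewrite Rintegral_itv_obnd_cbnd; last first.
    by apply: integrableS (ig n%:R n.+1%:R) => //; exact: subset_itv_oc_cc.
  rewrite shift IHn => /eqP; rewrite subr_eq => /eqP ->.
  by rewrite -natr1; ring.
have q0' : 0 < q%:R :> R by rewrite ltr0n.
have := @Rintegral_affine R g q%:R 0 0 1 q0' ler01 cg.
rewrite mulr0 mulr1 !addr0 sumE => /mulfI; rewrite gt_eqF// => /(_ isT) ->.
by apply: eq_Rintegral => x _; rewrite addr0.
Qed.

(** * The modulus and the character [e] *)

Lemma normcE (R : rcfType) (z : R[i]%C) :
  normc z = Num.sqrt (complex.Re z ^+ 2 + complex.Im z ^+ 2).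
Proof. by case: z. Qed.

Lemma Re_le_normc (R : rcfType) (z : R[i]%C) : complex.Re z <= normc z.
Proof.
rewrite normcE (le_trans (ler_norm _))// -sqrtr_sqr ler_wsqrtr//.
by rewrite lerDl sqr_ge0.
Qed.

Lemma normc_ge0 (R : rcfType) (z : R[i]%C) : 0 <= normc z.
Proof. by rewrite normcE sqrtr_ge0. Qed.

Lemma eD (R : realType) (x y : R) : e (x + y) = e x * e y.
Proof. by rewrite /e mulrDr cosD sinD; congr (_ +i* _)%C; ring. Qed.

Lemma normc_e (R : realType) (x : R) : normc (e x) = 1.
Proof. by rewrite normcE/= cos2Dsin2 sqrtr1. Qed.

Lemma e_nat (R : realType) (n : nat) : e (n%:R : R) = 1.
Proof.
rewrite /e (_ : 2 * pi * n%:R = 0 + pi *+ 2 *+ n); last first.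
  by rewrite add0r -[RHS]mulr_natr -[pi *+ 2]mulr_natl.
by rewrite (periodicn (@cosD2pi R)) (periodicn (@sinD2pi R)) cos0 sin0.
Qed.

Lemma Re_sum (R : rcfType) (s : seq nat) (f : nat -> R[i]%C) :
  complex.Re (\sum_(n <- s) f n) = \sum_(n <- s) complex.Re (f n).
Proof. exact: raddf_sum. Qed.

Lemma Im_sum (R : rcfType) (s : seq nat) (f : nat -> R[i]%C) :
  complex.Im (\sum_(n <- s) f n) = \sum_(n <- s) complex.Im (f n).
Proof. exact: raddf_sum. Qed.

(** * Integration of cosine sums *)

Lemma continuous_sum (R : realType) (I : Type) (s : seq I) (f : I -> R -> R) :
  (forall i, continuous (f i)) -> continuous (fun x => \sum_(i <- s) f i x).
Proof.
by move=> cf x; apply: cvg_big => [|i _]; [exact: add_continuous|exact: cf].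
Qed.

Lemma Rintegral_sum (R : realType) (I : Type) (s : seq I) (f : I -> R -> R) :
  (forall i, continuous (f i)) ->
  \int[@mu R]_(x in `[0, 1]) (\sum_(i <- s) f i x) =
  \sum_(i <- s) \int[@mu R]_(x in `[0, 1]) f i x.
Proof.
move=> cf.
have ig (g : R -> R) := @continuous_integrable_itv R g 0 1.
elim: s => [|i s IHs].
  rewrite big_nil -[RHS](mul0r (fine (mu `[0 : R, 1]))) -Rintegral_cst//.
  by apply: eq_Rintegral => x _; rewrite big_nil.
rewrite big_cons -IHs -RintegralD//; first last.
- by apply: ig; exact: continuous_sum.
- exact: ig.
by apply: eq_Rintegral => x _; rewrite big_cons.
Qed.

Lemma Rintegral01_cst (R : realType) (c : R) : \int[@mu R]_(x in `[0, 1]) c = c.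
Proof.
rewrite Rintegral_cst//.
by rewrite /= lebesgue_measure_itv/= lte01 sube0 mulr1.
Qed.

Lemma continuous_cosM (R : realType) (w : R) :
  continuous (fun x => cos (w * x)).
Proof.
move=> x; apply: continuous_comp; last exact: continuous_cos.
exact: mulrl_continuous.
Qed.

Lemma continuous_sinM (R : realType) (w : R) :
  continuous (fun x => sin (w * x)).
Proof.
move=> x; apply: continuous_comp; last exact: continuous_sin.
exact: mulrl_continuous.
Qed.

Lemma Rintegral_cos (R : realType) (w : R) : w != 0 ->
  \int[@mu R]_(x in `[0, 1]) cos (w * x) = sin w / w.
Proof.
move=> w0.
pose F (x : R) : R := w^-1 * sin (w * x).
have dF (x : R) : is_derive x (1 : R) F (cos (w * x)).
  apply: is_derive_eq; rewrite /GRing.scale/= !mulr1 mulrCA; field.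
  by rewrite w0.
have cF : continuous F.
  by move=> x; apply/differentiable_continuous/derivable1_diffP.
rewrite /Rintegral (@continuous_FTC2 R _ F 0 1)//.
- by rewrite /= /F mulr1 mulr0 sin0 mulr0 subr0 mulrC.
- by apply: continuous_subspaceT; exact: continuous_cosM.
- split; first by move=> x _.
  + by apply: cvg_at_right_filter; exact: cF.
  + by apply: cvg_at_left_filter; exact: cF.
- by move=> x _; rewrite derive1E derive_val.
Qed.

(** The real part of the orthogonality relation between e(m x) and e(n x). *)
Lemma Rintegral_cos_nat (R : realType) (m n : nat) :
  \int[@mu R]_(x in `[0, 1]) cos (2 * pi * (m%:R - n%:R) * x) = (m == n)%:R.
Proof.
have [->|mn] := eqVneq m n.
  rewrite -[RHS](@Rintegral01_cst R 1); apply: eq_Rintegral => x _.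
  by rewrite subrr mulr0 mul0r cos0.
rewrite Rintegral_cos; last first.
  rewrite !mulf_neq0 ?pnatr_eq0 ?subr_eq0 ?eqr_nat//.
  by rewrite gt_eqF ?pi_gt0.
(* This is the imaginary part of e(k) = 1. *)
have s0 k : sin (2 * pi * k%:R) = 0 :> R by have [] := @e_nat R k.
by rewrite mulrBr sinB !s0 mul0r mulr0 subr0 mul0r.
Qed.

(** Young's inequality for the product t * 1 with conjugate exponents p and p / (p - 1), multiplied
    by p. The left side is the tangent of t^p at t = 1. *)
Lemma powR_tangent (R : realType) (p t : R) : 1 < p -> 0 <= t ->
  p * t + (1 - p) <= t `^ p.
Proof.
move=> p1 t0; have p0 : 0 < p by lra.
have := @conjugate_powR R t 1 p (p / (p - 1)) t0 ler01 p0.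
rewrite divr_gt0 ?subr_gt0// powR1 mulr1 invf_div => /(_ isT).
have -> : p^-1 + (p - 1) / p = 1 by field; lra.
move=> /(_ erefl) /= h; have := ler_wpM2l (ltW p0) h.
rewrite (_ : p * (_ + _) = t `^ p + (p - 1)); first by lra.
by field; lra.
Qed.

(** * Moduli of trigonometric sums and a lower bound for their moments *)

Section trig_norm.
Context {R : realType}.
Implicit Types (s : seq nat) (alpha : R).

(** Frequencies form a list, so that deleting them is a filter and moving them is a map. *)
Definition trig_norm s alpha : R := normc (\sum_(n <- s) e (n%:R * alpha)).

Lemma trig_norm_ge0 s alpha : 0 <= trig_norm s alpha.
Proof. exact: normc_ge0. Qed.

Lemma continuous_trig_norm s : continuous (trig_norm s).
Proof.
have -> : trig_norm s = fun x =>
    Num.sqrt ((\sum_(n <- s) cos (2 * pi * n%:R * x)) ^+ 2 +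
              (\sum_(n <- s) sin (2 * pi * n%:R * x)) ^+ 2).
  apply/funext => x; rewrite /trig_norm normcE Re_sum Im_sum.
  congr (Num.sqrt (_ ^+ 2 + _ ^+ 2));
    by apply: eq_bigr => n _ /=; rewrite mulrA.
have sq (f : R -> R) : continuous f -> continuous (fun x => f x ^+ 2).
  by move=> cf x; apply: (@continuous_comp _ _ _ f (fun y => y ^+ 2));
    [exact: cf|exact: exprn_continuous].
move=> x; apply: continuous_comp; last exact: sqrt_continuous.
by apply: cvgD; apply: sq; apply: continuous_sum => n;
  [exact: continuous_cosM|exact: continuous_sinM].
Qed.

Lemma trig_normD1 s alpha : trig_norm s (alpha + 1) = trig_norm s alpha.
Proof.
rewrite /trig_norm; congr normc; apply: eq_bigr => n _.
by rewrite mulrDr mulr1 eD e_nat mulr1.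
Qed.

Lemma continuous_trig_norm_powR s (p : R) : 1 < p ->
  continuous (fun alpha => trig_norm s alpha `^ p).
Proof.
move=> p1 x.
have -> : (fun alpha => trig_norm s alpha `^ p) =
    (fun t => `|t| `^ p) \o trig_norm s.
  by apply/funext => y /=; rewrite ger0_norm ?trig_norm_ge0.
apply: continuous_comp; first exact: continuous_trig_norm.
exact: continuous_normr_powR.
Qed.

(* The real part of e(-n0 x) times the sum is a lower bound of integral 1 for
   its modulus; the tangent of t^p at t = 1 replaces Jensen's inequality. *)
Lemma trig_moment_ge1 s (p : R) n0 : 1 < p -> uniq s -> n0 \in s ->
  1 <= \int[@mu R]_(x in `[0, 1]) (trig_norm s x `^ p).
Proof.
move=> p1 us n0s; have p0 : 0 < p by lra.
pose h (x : R) := \sum_(n <- s) cos (2 * pi * (n%:R - n0%:R) * x).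
have ch : continuous h by apply: continuous_sum => n; exact: continuous_cosM.
have hle x : h x <= trig_norm s x.
  have -> : trig_norm s x =
      normc (\sum_(n <- s) (e (n%:R * x)) * e (- (n0%:R * x))).
    by rewrite -mulr_suml ComplexField.Normc.normcM normc_e mulr1.
  apply: le_trans (Re_le_normc _); rewrite Re_sum.
  by apply: ler_sum => n _; rewrite -eD /= -mulrBl mulrA.
have ch' : continuous (fun x => p * h x + (1 - p)).
  move=> x; apply: cvgD; last exact: cvg_cst.
  by apply: cvgM; [exact: cvg_cst|exact: ch].
have ig (g : R -> R) := @continuous_integrable_itv R g 0 1.
have h1 : \int[@mu R]_(x in `[0, 1]) (p * h x + (1 - p)) = 1.
  rewrite RintegralD//; last 2 first.
  - by apply: ig => x; apply: cvgM; [exact: cvg_cst|exact: ch].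
  - by apply: ig => x; exact: cvg_cst.
  rewrite Rintegral01_cst RintegralZl//; last exact: ig.
  rewrite Rintegral_sum; last by move=> n; exact: continuous_cosM.
  rewrite (bigD1_seq n0)//= Rintegral_cos_nat eqxx big1 => [|n nn0].
    by rewrite mulr1n addr0; ring.
  by rewrite Rintegral_cos_nat (negbTE nn0).
rewrite -[leLHS]h1.
apply: le_Rintegral => //; [exact: ig|exact/ig/continuous_trig_norm_powR|].
move=> x _; apply: le_trans (powR_tangent p1 (trig_norm_ge0 s x)).
by rewrite lerD2r ler_pM2l.
Qed.

End trig_norm.

(** * Deleting frequencies and transforming them affinely *)

Lemma normcN (R : rcfType) (z : R[i]%C) : normc (- z) = normc z.
Proof. by case: z => x y /=; rewrite !sqrrN. Qed.

Lemma trig_norm_le_size (R : realType) (s : seq nat) (alpha : R) :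
  trig_norm s alpha <= (size s)%:R.
Proof.
rewrite /trig_norm; elim: s => [|n s IHs].
  by rewrite big_nil ComplexField.Normc.normc0.
rewrite big_cons (le_trans (le_normcD _ _))//.
by rewrite normc_e /= -nat1r lerD2l.
Qed.

(** The filtered sum is the full sum minus the deleted terms, each of modulus 1. *)
Lemma trig_norm_filter (R : realType) (P : pred nat) (s : seq nat) (alpha : R) :
  trig_norm [seq n <- s | P n] alpha <=
  trig_norm s alpha + (count (predC P) s)%:R.
Proof.
rewrite -size_filter; have := trig_norm_le_size [seq n <- s | ~~ P n] alpha.
rewrite /trig_norm !big_filter => h; rewrite [in leRHS](bigID P)/=.
rewrite -[X in normc X <= _](addrK (\sum_(i <- s | ~~ P i) e (i%:R * alpha))).
by rewrite (le_trans (le_normcD _ _))// normcN lerD2l.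
Qed.

(** The sum x + y is at most twice the larger of the two. *)
Lemma powRD_le (R : realType) (p x y : R) : 0 < p -> 0 <= x -> 0 <= y ->
  (x + y) `^ p <= 2 `^ p * (x `^ p + y `^ p).
Proof.
move=> p0; wlog xy : x y / x <= y => [hw x0 y0|x0 y0].
  have [|/ltW] := leP x y; first by move=> /hw; exact.
  by move=> /hw; rewrite [y + x]addrC [y `^ p + _]addrC; exact.
apply: (@le_trans _ _ ((2 * y) `^ p)).
  by apply: ge0_ler_powR; rewrite ?nnegrE; lra.
by rewrite powRM// ler_wpM2l ?powR_ge0// lerDr powR_ge0.
Qed.

(** Pointwise the deletion raises the modulus by at most k; the bound for the p-th power of a sum is
    then integrated over an interval of length 1. *)
Lemma trig_moment_filter (R : realType) (p : R) (P : pred nat) (s : seq nat)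
    (k : nat) : 1 < p -> (count (predC P) s <= k)%N ->
  \int[@mu R]_(x in `[0, 1]) (trig_norm [seq n <- s | P n] x `^ p) <=
  2 `^ p * (\int[@mu R]_(x in `[0, 1]) (trig_norm s x `^ p) + k%:R `^ p).
Proof.
move=> p1 kP; have p0 : 0 < p by lra.
have ig (g : R -> R) := @continuous_integrable_itv R g 0 1.
have cT s' : continuous (fun x : R => trig_norm s' x `^ p).
  exact: continuous_trig_norm_powR.
have cTk : continuous (fun x : R => trig_norm s x `^ p + k%:R `^ p).
  by move=> x; apply: cvgD; [exact: cT|exact: cvg_cst].
rewrite -[k%:R `^ p in leRHS]Rintegral01_cst.
rewrite -RintegralD//; [|exact: ig|by apply: ig => x; exact: cvg_cst].
rewrite -RintegralZl//; last exact: ig.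
apply: le_Rintegral => //; first exact: ig.
  by apply: ig => x; apply: cvgM; [exact: cvg_cst|exact: cTk].
move=> x _; apply: le_trans (powRD_le p0 (trig_norm_ge0 _ _) (ler0n _ _)).
apply: ge0_ler_powR; rewrite ?nnegrE ?addr_ge0 ?trig_norm_ge0 ?(ltW p0)//.
by rewrite (le_trans (trig_norm_filter P s x))// lerD2l ler_nat.
Qed.

(** The sum over the images is the sum at q alpha times e(a alpha), which has modulus 1. The
    equation for f is asked on s only, since q n + a may be negative elsewhere. *)
Lemma trig_norm_affine (R : realType) (q : nat) (a : int) (f : nat -> nat)
    (s : seq nat) (alpha : R) :
  {in s, forall n, (f n)%:Z = q%:Z * n%:Z + a} ->
  trig_norm [seq f n | n <- s] alpha = trig_norm s (q%:R * alpha).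
Proof.
move=> fE; rewrite /trig_norm big_map.
rewrite -[RHS]mulr1 -[X in _ * X](@normc_e R (a%:~R * alpha)).
rewrite -ComplexField.Normc.normcM mulr_suml !big_seq; congr normc.
apply: eq_bigr => n /fE fn; rewrite -eD; congr e.
have -> : (f n)%:R = q%:R * n%:R + a%:~R :> R.
  by rewrite pmulrn fn intrD intrM.
by ring.
Qed.

(** * Truncations of the affine image *)

Lemma mem_trunc_set (D : set nat) (N n : nat) :
  (n \in fset_set (trunc_set D N)) = (n \in D) && (1 <= n <= N)%N.
Proof.
rewrite in_fset_set; last first.
  by apply: (@sub_finite_set _ _ `I_N.+1) => // m [_ /andP[]].
apply/idP/andP => [|[]]; first by rewrite inE => -[? ?]; rewrite inE.
by rewrite !inE.
Qed.

(** For a <= N the natural number |N - a| is N - a, so n <= (N - a) / q, rounded down, says exactly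
    that q n + a <= N. The filter keeps the positive values, on which the absolute value is only a
    cast from integers to naturals. *)
Lemma perm_affine_trunc (q : nat) (a : int) (A : set nat) (N : nat) :
  (0 < q)%N -> A `<=` pnat_set -> a <= N%:Z ->
  perm_eq (fset_set (trunc_set (affine_image q a A) N))
    [seq `|(q%:Z * n%:Z + a)%R|%N |
       n <- fset_set (trunc_set A (`|(N%:Z - a)%R|%N %/ q)) &
       (0 < q%:Z * n%:Z + a)%R].
Proof.
move=> q0 Apos aN; apply: uniq_perm; first exact: fset_uniq.
  rewrite map_inj_in_uniq ?filter_uniq ?fset_uniq// => m n.
  by rewrite !mem_filter => /andP[m0 _] /andP[n0 _] ?; nia.
have dN n : (n <= `|(N%:Z - a)%R|%N %/ q)%N = (q%:Z * n%:Z + a <= N%:Z).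
  by rewrite leq_divRL//; apply/idP/idP; nia.
move=> m; rewrite mem_trunc_set; apply/idP/mapP.
  case/andP; rewrite inE => -[m0 [n An mE]] /andP[_ mN].
  have n0 := Apos _ An.
  exists n; last by rewrite -mE.
  rewrite mem_filter mem_trunc_set mem_set//= dN -mE n0.
  by move: m0 mN; rewrite /pnat_set/=; lia.
case=> n; rewrite mem_filter mem_trunc_set dN.
move=> /andP[m0 /and3P[nA n0 nN]] ->.
rewrite mem_set/=; first by lia.
split; first by rewrite /pnat_set/=; lia.
by exists n; [exact/set_mem|lia].
Qed.

(** If q n + a <= 0 with q, n >= 1, then 1 <= n <= |a|. *)
Lemma count_nonpos_affine (q : nat) (a : int) (s : seq nat) :
  (0 < q)%N -> uniq s -> {in s, forall n, 0 < n}%N ->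
  (count (predC (fun n : nat => 0 < q%:Z * n%:Z + a)%R) s <= `|a|)%N.
Proof.
move=> q0 us s0; rewrite -size_filter -[leqRHS](size_iota 1).
apply: uniq_leq_size; first exact: filter_uniq.
move=> n; rewrite mem_filter mem_iota /= => /andP[na /s0 n0].
by nia.
Qed.

(** * Moments and counts of a set and of its affine image *)

Lemma trig_norm_perm (R : realType) (s t : seq nat) :
  perm_eq s t -> @trig_norm R s =1 trig_norm t.
Proof. by move=> st x; rewrite /trig_norm (perm_big _ st). Qed.

Lemma momentE (R : realType) (p : R) (N : nat) (D : set nat) :
  moment p N D =
  \int[@mu R]_(x in `[0, 1]) (trig_norm (fset_set (trunc_set D N)) x `^ p).
Proof. by []. Qed.

Lemma moment_ge1 (R : realType) (p : R) (N n : nat) (D : set nat) :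
  1 < p -> D n -> (1 <= n <= N)%N -> 1 <= moment p N D.
Proof.
move=> p1 Dn nN; rewrite momentE.
apply: (trig_moment_ge1 p1 (fset_uniq _) (n0 := n)).
by rewrite mem_trunc_set mem_set.
Qed.

(** If all elements were at most k, then D(M) <= k and 1 <= C k^p / M for all large M, which fails
    as soon as M > C k^p. *)
Lemma strongly_subconvex_unbounded (R : realType) (p : R) (D : set nat)
    (k : nat) : 1 < p -> strongly_subconvex p D -> exists2 n, D n & (k < n)%N.
Proof.
move=> p1 [Dpos [n0 Dn0] _ [C C0 [N0 _ hC]]].
apply: contrapT => nk.
have Dk n : D n -> (n <= k)%N.
  by move=> Dn; rewrite leqNgt; apply/negP => kn; apply: nk; exists n.
pose T := C * k%:R `^ p.
have T0 : 0 <= T by rewrite mulr_ge0 ?powR_ge0// ltW.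
(* M passes the threshold N0, reaches the element n0 so that the moment is at least 1, and exceeds
   T. *)
pose M := maxn (maxn N0 n0) (Num.truncn T).+1.
have M0 : 0 < M%:R :> R by rewrite ltr0n; lia.
have TM : T < M%:R.
  by rewrite (lt_le_trans (truncnS_gt T))// ler_nat leq_maxr.
have I1 : 1 <= moment p M D.
  by apply: (moment_ge1 p1 Dn0); rewrite (Dpos _ Dn0); lia.
have cM : (count_set D M <= k)%N.
  rewrite -[leqRHS](size_iota 1); apply: uniq_leq_size; first exact: fset_uniq.
  move=> n; rewrite mem_trunc_set mem_iota => /andP[/set_mem/Dk]; lia.
have := le_trans I1 (hC M ltac:(rewrite /=; lia)).
rewrite mulrCA ler_pdivlMl// mulr1 leNgt => /negP; apply.
rewrite (le_lt_trans _ TM)// ler_wpM2l ?(ltW C0)//.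
by apply: ge0_ler_powR; rewrite ?nnegrE ?ler0n ?ler_nat//; lra.
Qed.

(** Dilation by q and translation by a leave the moment unchanged, so the only loss comes from the
    at most |a| deleted frequencies. *)
Lemma moment_affine_le (R : realType) (p : R) (q : nat) (a : int) (A : set nat)
    (N : nat) : 1 < p -> (0 < q)%N -> A `<=` pnat_set -> a <= N%:Z ->
  moment p N (affine_image q a A) <=
  2 `^ p * (moment p (`|(N%:Z - a)%R|%N %/ q) A + `|a|%N%:R `^ p).
Proof.
move=> p1 q0 Apos aN; set M := (_ %/ q)%N.
set P := fun n : nat => (0 < q%:Z * n%:Z + a)%R.
set s := fset_set (trunc_set A M).
have -> : moment p N (affine_image q a A) =
    \int[@mu R]_(x in `[0, 1]) (trig_norm [seq n <- s | P n] x `^ p).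
  (* The right side is rewritten with q x for x, to match the affine image pointwise. *)
  rewrite momentE -[RHS](@Rintegral_periodic_scale R _ q)//; last 2 first.
  - exact: continuous_trig_norm_powR.
  - by move=> x; rewrite trig_normD1.
  apply: eq_Rintegral => x _.
  rewrite (trig_norm_perm (perm_affine_trunc _ _ _))//.
  rewrite (@trig_norm_affine R q a)// => n; rewrite mem_filter => /andP[Pn _].
  by rewrite gez0_abs// ltW.
apply: trig_moment_filter => //.
apply: (count_nonpos_affine a q0 (fset_uniq _)) => n.
by rewrite mem_trunc_set => /and3P[].
Qed.

Lemma count_affine_ge (q : nat) (a : int) (A : set nat) (N : nat) :
  (0 < q)%N -> A `<=` pnat_set -> a <= N%:Z ->
  (count_set A (`|(N%:Z - a)%R|%N %/ q) <=
   count_set (affine_image q a A) N + `|a|)%N.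
Proof.
move=> q0 Apos aN; rewrite [count_set (affine_image _ _ _) _]/count_set.
rewrite (perm_size (perm_affine_trunc _ _ _))// size_map size_filter.
rewrite -[leqLHS](count_predC (fun n : nat => 0 < q%:Z * n%:Z + a)%R).
rewrite leq_add2l; apply: (count_nonpos_affine a q0 (fset_uniq _)) => n.
by rewrite mem_trunc_set => /and3P[].
Qed.

(** * Choice of the constant and the threshold for the affine image *)

Theorem theorem3p4 (R : realType) (p : R) (A : set nat)
  (hA : strongly_subconvex p A) (hp : 1 < p) (q : nat) (hq : (0 < q)%N)
  (a : int) :
  strongly_subconvex p (affine_image q a A).
Proof.
(* Since q >= 1, an element n1 > |a| of A has q n1 + a > 0 and so yields the element m1 of B. *)
have [n1 An1 n1a] := strongly_subconvex_unbounded `|a|%N hp hA.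
case: hA => Apos _ p02 [C C0 [N0 _ hC]]; have p0 : 0 < p by lra.
set B := affine_image q a A; set k := `|a|%N.
pose m1 := `|(q%:Z * n1%:Z + a)%R|%N.
have m1E : m1%:Z = q%:Z * n1%:Z + a by rewrite /m1 gez0_abs//; nia.
have m1_gt0 : (0 < m1)%N by nia.
have Bm1 : B m1 by split=> //; exists n1.
split=> //; [by move=> m []|by exists m1|].
(* This gives N <= c M, because N - a < (M + 1) q and M >= 1. *)
pose c := (2 * q + k)%N.
(* The factors account in turn for the deletion, the absorption of k^p into the moment of A, the
   bound for A, the passage from 1/M to 1/N, and the passage from A(M) to B(N). *)
exists (2 `^ p * (1 + k%:R `^ p) * C * c%:R * (1 + k)%:R `^ p).
  have c0 : (0 < c)%N by rewrite /c; lia.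
  have k0 : 0 < 1 + k%:R `^ p by rewrite ltr_wpDr ?powR_ge0.
  by rewrite !mulr_gt0 ?powR_gt0 ?ltr0n.
(* The first two summands force M >= N0 and M >= n1; the last one puts m1 into B(N). *)
exists (q * (maxn N0 n1) + k + m1)%N => // N /= NN.
have aN : a <= N%:Z by lia.
set M := (`|(N%:Z - a)%R|%N %/ q)%N.
have MN : (maxn N0 n1 <= M)%N by rewrite leq_divRL//; lia.
have n1M : (1 <= n1 <= M)%N by lia.
have NcM : (N <= c * M)%N.
  have : (`|(N%:Z - a)%R| < M.+1 * q)%N by rewrite -ltn_divLR.
  by rewrite /c; nia.
have hI : moment p M A <= C * (M%:R^-1 * (count_set A M)%:R `^ p).
  by apply: hC; rewrite /=; lia.
have I1 : 1 <= moment p M A := moment_ge1 hp An1 n1M.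
have B1 : (0 < count_set B N)%N.
  rewrite /count_set cardfs_gt0; apply/fset0Pn; exists m1.
  by rewrite mem_trunc_set mem_set//=; lia.
(* The additive loss k becomes a factor because B(N) >= 1. *)
have AB : (count_set A M <= (1 + k) * count_set B N)%N.
  by apply: leq_trans (count_affine_ge hq Apos aN) _; rewrite -/B; nia.
have N0' : 0 < N%:R :> R by rewrite ltr0n; lia.
have M0 : 0 < M%:R :> R by rewrite ltr0n; lia.
have kp0 : 0 <= k%:R `^ p :> R by exact: powR_ge0.
apply: (le_trans (moment_affine_le hp hq Apos aN)).
rewrite -!mulrA ler_pM2l ?powR_gt0// -/M -/k.
(* Here k^p is absorbed using that the moment of A is at least 1. *)
apply: (@le_trans _ _ ((1 + k%:R `^ p) * moment p M A)).
  by rewrite mulrDl mul1r lerD2l ler_peMr.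
rewrite ler_pM2l ?ltr_wpDr//; apply: (le_trans hI); rewrite ler_pM2l//.
(* Regrouped so that 1/M <= c/N and the bound on A(M) can be applied factor by factor. *)
have -> : c%:R * ((1 + k)%:R `^ p * (N%:R^-1 * (count_set B N)%:R `^ p)) =
   (c%:R / N%:R) * ((1 + k) * count_set B N)%:R `^ p :> R.
  by rewrite natrM powRM//; ring.
apply: ler_pM; rewrite ?powR_ge0 ?invr_ge0 ?ler0n//.
  by rewrite ler_pdivlMr// ler_pdivrMl// -natrM ler_nat mulnC.
by apply: ge0_ler_powR; rewrite ?nnegrE ?ler0n ?ler_nat ?(ltW p0).
Qed.
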